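(* For all integers $\ell \geq 1$, \begin{align*} 4 t(\overline{1},\overline{2\ell+1}) = {} & \frac{1}{2^{2\ell}} \zeta(\overline{2\ell+1},1) - 2 \sum_{j=1}^{2\ell+1} \frac{1}{2^j} \zeta(\overline{j}, 2\ell+2-j) \\ & + \frac{3}{2^{2\ell+1}} \zeta(\overline{2\ell+2}) - \sum_{r=1}^{2\ell} \frac{(-1)^r}{2^{r-1}} \zeta(\overline{r}) \zeta(2\ell+2-r) . \end{align*} In particular $t(\overline{1}, \overline{2\ell+1})$ is expressed through the depth 2 alternating multiple zeta values $\zeta(\overline j,2\ell+2-j)$ and products involving Riemann zeta values and $\log(2)$.
   Context: The alternating double $t$ value is $$t(\overline1,\overline{2\ell+1})=\sum_{m_1>m_2>0}\frac{(-1)^{m_1}(-1)^{m_2}}{(2m_1-1)(2m_2-1)^{2\ell+1}}$$ (limit of partial sums over $m_1\le N$). $\zeta$ is the Riemann zeta function; for integers $a,b\ge1$, $\zeta(\overline a)=\sum_{n\ge1}\frac{(-1)^n}{n^a}$ (so $\zeta(\overline1)=-\log2$) and $\zeta(\overline a,b)=\sum_{n>m>0}\frac{(-1)^n}{n^am^b}$ (limit of partial sums over $n\le N$). *)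

(* Defs.v *)
(* Library world: MathComp-Analysis; the reals are an arbitrary realType. *)
From HB Require Import structures.
From mathcomp Require Import all_boot all_order all_algebra.
From mathcomp Require Import all_classical all_reals all_analysis.

Set Implicit Arguments.
Unset Strict Implicit.
Unset Printing Implicit Defensive.

Import Order.TTheory GRing.Theory Num.Theory.
Import numFieldNormedType.Exports.

Local Open Scope classical_set_scope.
Local Open Scope ring_scope.

(* The suffix [_psum] marks the partial sum over outer indices at most [N].
   [limn] is total, so a value below is meaningful only where its sequence of
   partial sums converges. *)

Definition zeta_psum (R : realType) (s N : nat) : R :=
  \sum_(1 <= n < N.+1) (n%:R ^+ s)^-1.

(* The Riemann zeta function at an integer [s >= 2]. *)
Definition zeta (R : realType) (s : nat) : R := limn (@zeta_psum R s).

(* In the names below, [bar] marks an overlined argument, i.e. the presence of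
   the sign (-1)^n for the corresponding summation index. *)
Definition zeta_bar_psum (R : realType) (a N : nat) : R :=
  \sum_(1 <= n < N.+1) (-1) ^+ n / n%:R ^+ a.

Definition zeta_bar (R : realType) (a : nat) : R := limn (@zeta_bar_psum R a).

Definition zeta_bar2_psum (R : realType) (a b N : nat) : R :=
  \sum_(1 <= n < N.+1) \sum_(1 <= m < n)
    (-1) ^+ n / (n%:R ^+ a * m%:R ^+ b).

(* zeta(\bar a, b) *)
Definition zeta_bar2 (R : realType) (a b : nat) : R :=
  limn (@zeta_bar2_psum R a b).

Definition t_bar_bar_psum (R : realType) (a b N : nat) : R :=
  \sum_(1 <= m1 < N.+1) \sum_(1 <= m2 < m1)
    ((-1) ^+ m1 * (-1) ^+ m2) /
    ((2 * m1%:R - 1) ^+ a * (2 * m2%:R - 1) ^+ b).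

(* t(\bar a, \bar b) *)
Definition t_bar_bar (R : realType) (a b : nat) : R :=
  limn (@t_bar_bar_psum R a b).

(* Main.v *)
Require Import Defs.
From HB Require Import structures.
From mathcomp Require Import all_boot all_order all_algebra.
From mathcomp Require Import all_classical all_reals all_analysis.
From mathcomp Require Import ring lra zify.

(** Put [w = 2 l + 1] and, for [e] in [{0, 1}], [x_p = 2 p - e]. Let [D_e] be
    the sum of [(-1)^(p+q) / (x_q x_p^w)] over [p < q], so that [D_1] is the
    alternating double t value and [D_0] is [2^-(w+1)] times the alternating
    double zeta value with both arguments barred. The evaluation is the
    elimination of one auxiliary series between two computations.

    First, writing [q = p + k] turns the summand into
    [(-1)^k / (x_p^w (x_p + 2 k))]. Since [w] is odd, the partial fraction
    decomposition ([partial_fraction]) and the telescoping in [p] of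
    [1 / x_p - 1 / (x_p + 2 k)] give
      [D_e = A_e - sum_(1 <= r < w) (-1)^r 2^-r zeta_bar(r) X_e(w + 1 - r)],
    where [X_e(j)] is the sum of the [x_p^-j] and [A_e] is the sum over [k] of
    [(-1)^k (2 k)^-w (1 / x_1 + ... + 1 / x_k)] ([node_dsum_cvg]). The number
    [A_0] is a combination of [zeta_bar2 w 1] and [zeta_bar (w + 1)], and
    [X_0(j) + X_1(j) = zeta j].

    Secondly, let [S] be the sum of the [2^-j zeta_bar2 j (w + 1 - j)] over
    [1 <= j <= w]. Summing over [j] first is a geometric sum, and [S] becomes
    the sum over [m < n] of [(-1)^n (m^-w - (2 n)^-w) / (2 n - m)]. With
    [n = m + k], the terms in [m^-w] are [(-1)^(m+k) / (m^w (m + 2 k))]; the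
    even and the odd [m] contribute [D_0] and [- D_1]. The terms in [(2 n)^-w]
    sum to [- B], where [A_1 - B] is again a combination of [zeta_bar2 w 1] and
    [zeta_bar (w + 1)] ([node_diag_odd]). Hence
      [S + B = D_0 - D_1],
    and adding [D_1 = A_1 - ...] eliminates [A_1] and [B], leaving [2 D_1] in
    closed form ([t_bar_bar_odd_eval]).

    The series converge only conditionally, so everything is done with partial
    sums up to [N]. Changing the range of [k], in the inner alternating sum
    attached to [x_p], costs at most the first omitted term, which is
    [O(1 / N)] uniformly in [p] ([alt_recip_close]); the factor [x_p^-w] is
    summable, so the total error tends to [0].

    The last assertion follows by expressing [zeta_bar r] through [zeta r], or
    through [ln 2] when [r = 1]. *)

Set Implicit Arguments.
Unset Strict Implicit.
Unset Printing Implicit Defensive.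

Import Order.TTheory GRing.Theory Num.Theory.
Import numFieldNormedType.Exports.

Local Open Scope classical_set_scope.
Local Open Scope ring_scope.

(** * Alternating sums and convergence of the series *)

Lemma alt_sum_bounds (R : realType) (c : nat -> R) (K d : nat) :
  (forall k, (K <= k)%N -> c k.+1 <= c k) ->
  (forall k, (K <= k)%N -> 0 <= c k) ->
  0 <= \sum_(0 <= i < d) (-1) ^+ i * c (K + i)%N <= c K.
Proof.
elim: d K => [|d IH] K cK c0; first by rewrite big_geq// lexx c0.
rewrite big_nat_recl// expr0 mul1r addn0.
have -> : \sum_(0 <= i < d) (-1) ^+ i.+1 * c (K + i.+1)%N =
    - \sum_(0 <= i < d) (-1) ^+ i * c (K.+1 + i)%N.
  by rewrite -sumrN; apply: eq_bigr => i _; rewrite exprS addnS addSn; ring.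
have /andP[s0 s1] := IH K.+1 (fun k hk => cK k (ltnW hk))
  (fun k hk => c0 k (ltnW hk)).
have := cK K (leqnn K); lra.
Qed.

Lemma alt_sum_norm_le (R : realType) (c : nat -> R) (K M : nat) :
  (forall k, (K <= k)%N -> c k.+1 <= c k) ->
  (forall k, (K <= k)%N -> 0 <= c k) ->
  `|\sum_(K <= k < M) (-1) ^+ k * c k| <= c K.
Proof.
move=> cK c0.
rewrite -{1}[K]add0n big_addn.
have -> : \sum_(0 <= i < M - K) (-1) ^+ (i + K) * c (i + K)%N =
    (-1) ^+ K * \sum_(0 <= i < M - K) (-1) ^+ i * c (K + i)%N.
  by rewrite mulr_sumr; apply: eq_bigr => i _; rewrite exprD addnC; ring.
have /andP[s0 s1] := alt_sum_bounds (M - K) cK c0.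
by rewrite normrM normrX normrN1 expr1n mul1r ger0_norm.
Qed.

(** Leibniz's criterion, for a sequence that is monotone from rank [K] on. *)
Lemma leibniz_cvg (R : realType) (c : nat -> R) (K : nat) :
  (forall k, (K <= k)%N -> c k.+1 <= c k) ->
  (forall k, (K <= k)%N -> 0 <= c k) ->
  c @ \oo --> 0 ->
  cvgn (fun N => \sum_(1 <= k < N.+1) (-1) ^+ k * c k : R).
Proof.
move=> cK c0 cz.
suff : cvgn (series (fun k => (-1) ^+ k * c k)).
  move=> /cvg_ex[/= L]; rewrite -cvg_shiftS => hL.
  apply/cvg_ex; exists (L - (-1) ^+ 0 * c 0%N).
  have -> : (fun N => \sum_(1 <= k < N.+1) (-1) ^+ k * c k : R) =
    (fun N => series (fun k => (-1) ^+ k * c k) N.+1 - (-1) ^+ 0 * c 0%N).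
    by apply/funext => N; rewrite /series /= [X in _ = X - _]big_ltn// [RHS]addrC addKr.
  by apply: cvgB => //; exact: cvg_cst.
apply/cauchy_cvgP/cauchy_seriesP => e e0.
have [M _ HM] : \forall n \near \oo, `|c n| < e by move: cz => /cvgr0Pnorm_lt; apply.
exists ([set n | (maxn K M <= n)%N], setT) => /=.
  split; [by exists (maxn K M)|exact: filterT].
move=> [n1 n2] /= [hn _].
apply: (le_lt_trans (@alt_sum_norm_le _ _ _ _ _ _)).
- by move=> k hk; apply: cK; lia.
- by move=> k hk; apply: c0; lia.
- by apply: (le_lt_trans (ler_norm _)); apply: HM => /=; lia.
Qed.

Lemma cvg0_le_inv (R : realType) (u : nat -> R) (C : R) :
  (forall N, `|u N| <= C * N.+1%:R^-1) -> u @ \oo --> 0.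
Proof.
move=> hu.
have hC : (fun N => C * harmonic N) @ \oo --> (0 : R).
  by rewrite -[0](mulr0 C); apply: cvgM; [exact: cvg_cst|exact: cvg_harmonic].
apply: (squeeze_cvgr (f := fun N => - (C * harmonic N)) _ _ hC).
- by apply: nearW => N; rewrite -ler_norml; apply: hu.
- by rewrite -[0]oppr0; apply: cvgN.
Qed.

Lemma cvg_harmonic_mean0 (R : realType) :
  (fun n => (\sum_(1 <= m < n.+1) m%:R^-1) / n%:R : R) @ \oo --> 0.
Proof.
rewrite -cvg_shiftS.
have := cesaro (@cvg_harmonic R); apply: cvg_trans; apply: near_eq_cvg.
by apply: nearW => n /=; rewrite /arithmetic_mean /series /= big_add1 mulrC.
Qed.

Lemma sum_inv_sqr_le (R : realType) N :
  \sum_(1 <= m < N.+1) (m%:R ^+ 2)^-1 <= 2 :> R.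
Proof.
suff h M : \sum_(1 <= m < M.+2) (m%:R ^+ 2)^-1 <= 2 - M.+1%:R^-1 :> R.
  case: N => [|N]; first by rewrite big_geq.
  by apply: (le_trans (h N)); rewrite gerBl invr_ge0.
elim: M => [|M IH]; first by rewrite big_nat1 expr1n invr1; lra.
rewrite big_nat_recr//=; apply: (le_trans (lerD IH (lexx _))).
have h : (0 : R) < M.+1%:R by rewrite ltr0n.
rewrite -[M.+2]addn1 natrD -subr_ge0.
have -> : 2 - (M.+1%:R + 1)^-1 - (2 - M.+1%:R^-1 + ((M.+1%:R + 1) ^+ 2)^-1) =
    (M.+1%:R * (M.+1%:R + 1) ^+ 2)^-1 :> R by field; lra.
by rewrite invr_ge0 mulr_ge0 ?sqr_ge0// ltW.
Qed.

Lemma inv_expr_le_sqr (R : realType) (s n : nat) : (2 <= s)%N -> (1 <= n)%N ->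
  (n%:R ^+ s)^-1 <= (n%:R ^+ 2)^-1 :> R.
Proof.
move=> hs hn; have n0 : (0 : R) < n%:R by rewrite ltr0n.
by rewrite lef_pV2 ?posrE ?exprn_gt0// ler_weXn2l// ler1n.
Qed.

Lemma zeta_psum_cvg (R : realType) (s : nat) : (2 <= s)%N ->
  cvgn (@zeta_psum R s).
Proof.
move=> hs; apply: nondecreasing_is_cvgn.
  apply/nondecreasing_seqP => n.
  by rewrite /zeta_psum [leRHS]big_nat_recr//= lerDl invr_ge0 exprn_ge0.
exists 2 => _ [N _ <-]; apply: le_trans (sum_inv_sqr_le R N).
by apply: ler_sum_nat => n /andP[hn _]; apply: inv_expr_le_sqr.
Qed.

(** The hypotheses say that [h >= 1] is nondecreasing and grows at most like the
    harmonic numbers; they make [h n / n ^ a] decrease to [0]. The value of [h]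
    at [1] is left free, because the inner sum of a double zeta value vanishes
    there. *)
Lemma alt_sum_cvg (R : realType) (h : nat -> R) (a : nat) : (1 <= a)%N ->
  (forall n, (2 <= n)%N -> 1 <= h n) ->
  (forall n, (2 <= n)%N -> h n <= h n.+1) ->
  (forall n, (2 <= n)%N -> h n.+1 <= h n + n%:R^-1) ->
  cvgn (fun N => \sum_(1 <= n < N.+1) (-1) ^+ n * (h n / n%:R ^+ a) : R).
Proof.
move=> ha h1 hnd hinc.
have n0 n : (2 <= n)%N -> (0 : R) < n%:R by move=> ?; rewrite ltr0n; lia.
apply: (@leibniz_cvg _ _ 2) => [n hn|n hn|].
- rewrite ler_pdivrMr ?exprn_gt0 ?ltr0n// mulrAC ler_pdivlMr ?exprn_gt0 ?n0//.
  apply: (le_trans (ler_wpM2r _ (hinc n hn))); first by rewrite exprn_ge0.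
  (* (n + 1) ^ a - n ^ a >= n ^ (a - 1), and h n >= 1 *)
  case: a ha => // a _.
  have e1 : n%:R ^+ a.+1 + n%:R ^+ a <= n.+1%:R ^+ a.+1 :> R.
    rewrite -[n.+1]addn1 natrD [leRHS]exprS exprS -[X in _ + X]mul1r -mulrDl.
    by rewrite ler_pM2l ?lerXn2r ?nnegrE ?lerDl ?addr_ge0// ltr_wpDr// n0.
  apply: (@le_trans _ _ (h n * (n%:R ^+ a.+1 + n%:R ^+ a))); last first.
    by rewrite ler_wpM2l// (le_trans _ (h1 n hn)).
  rewrite mulrDl mulrDr lerD2l exprS mulrA mulVf ?mul1r ?gt_eqF ?n0//.
  by rewrite -{1}[_ ^+ a]mul1r ler_wpM2r ?exprn_ge0// h1.
- by rewrite divr_ge0 ?exprn_ge0// (le_trans _ (h1 n hn)).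
- have hle k : h k.+2 <= `|h 2| + \sum_(1 <= m < k.+3) m%:R^-1.
    suff hk : h k.+2 <= `|h 2| + \sum_(1 <= m < k.+2) m%:R^-1.
      by rewrite big_nat_recr//= addrA ler_wpDr.
    elim: k => [|k IH]; first by rewrite ler_wpDr ?ler_norm// sumr_ge0.
    rewrite big_nat_recr//= addrA; apply: (le_trans (hinc k.+2 _)) => //.
    by rewrite lerD2r.
  have hz : (fun n => `|h 2| * n%:R^-1 +
      (\sum_(1 <= m < n.+1) m%:R^-1) / n%:R : R) @ \oo --> 0.
    have hi : (fun n => n%:R^-1 : R) @ \oo --> (0 : R).
      by rewrite -cvg_shiftS; exact: cvg_harmonic.
    have := cvgD (cvgM (cvg_cst `|h 2|) hi) (@cvg_harmonic_mean0 R).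
    by rewrite mulr0 addr0; apply.
  apply: (squeeze_cvgr _ (cvg_cst (0 : R)) hz).
  exists 2 => // n /= hn; apply/andP; split.
    by rewrite divr_ge0 ?exprn_ge0// (le_trans _ (h1 n hn)).
  rewrite -mulrDl; apply: ler_pM; rewrite ?invr_ge0 ?exprn_ge0//.
  + by rewrite (le_trans _ (h1 n hn)).
  + by case: n hn => [|[|n]].
  + by rewrite lef_pV2 ?posrE ?exprn_gt0 ?n0// ler_eXnr// ler1n; lia.
Qed.

Lemma zeta_bar_psum_cvg (R : realType) (a : nat) : (1 <= a)%N ->
  cvgn (@zeta_bar_psum R a).
Proof.
move=> ha.
have -> : @zeta_bar_psum R a =
    fun N => \sum_(1 <= n < N.+1) (-1) ^+ n * (1 / n%:R ^+ a).
  by apply/funext => N; apply: eq_bigr => n _; rewrite mul1r.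
by apply: (@alt_sum_cvg R (fun=> 1)) => // n hn; rewrite lerDl invr_ge0.
Qed.

Lemma zeta_bar2_psumE (R : realType) (a b N : nat) :
  zeta_bar2_psum R a b N = \sum_(1 <= n < N.+1)
    (-1) ^+ n * ((\sum_(1 <= m < n) (m%:R ^+ b)^-1) / n%:R ^+ a).
Proof.
apply: eq_bigr => n _; rewrite mulrA [RHS]mulrAC mulr_sumr.
by apply: eq_bigr => m _; rewrite invfM mulrA.
Qed.

Lemma zeta_bar2_psum_cvg (R : realType) (a b : nat) :
  (1 <= a)%N -> (1 <= b)%N -> cvgn (@zeta_bar2_psum R a b).
Proof.
move=> ha hb; rewrite (funext (zeta_bar2_psumE R a b)).
apply: (@alt_sum_cvg R (fun n => \sum_(1 <= m < n) (m%:R ^+ b)^-1)) => // n hn.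
- by rewrite big_ltn// expr1n invr1 lerDl sumr_ge0.
- by rewrite [leRHS]big_nat_recr//= ?lerDl ?invr_ge0 ?exprn_ge0//; lia.
- rewrite big_nat_recr//=; last lia.
  by rewrite lerD2l lef_pV2 ?posrE ?exprn_gt0 ?ltr0n ?ler_eXnr ?ler1n//; lia.
Qed.

(** * Finite identities *)

(** Writing [q = p + k] in a sum over [p < q]. *)
Lemma triangle_sum (V : nmodType) (F : nat -> nat -> V) (N : nat) :
  \sum_(1 <= q < N.+1) \sum_(1 <= p < q) F p q =
  \sum_(1 <= p < N.+1) \sum_(1 <= k < (N - p).+1) F p (p + k)%N.
Proof.
elim: N => [|N IH]; first by rewrite !big_geq.
rewrite big_nat_recr//= IH [RHS]big_nat_recr//= subnn [X in _ = _ + X]big_geq//.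
rewrite addr0 -big_split /=; apply: eq_big_nat => p /andP[p1 pN].
by rewrite subSn// [RHS]big_nat_recr//= addnS subnKC.
Qed.

Lemma sum_odd_even (V : nmodType) (f : nat -> V) (N : nat) :
  \sum_(1 <= m < (2 * N).+1) f m =
  \sum_(1 <= p < N.+1) (f (2 * p - 1)%N + f (2 * p)%N).
Proof.
elim: N => [|N IH]; first by rewrite !big_geq.
rewrite [RHS]big_nat_recr//= -IH.
have -> : (2 * N.+1 = (2 * N).+2)%N by lia.
by rewrite big_nat_recr//= big_nat_recr//= -addrA subn1.
Qed.

Lemma partial_fraction (F : fieldType) (x y : F) (w : nat) : (1 <= w)%N ->
  x != 0 -> y != 0 -> x + y != 0 ->
  (x ^+ w * (x + y))^-1 =
    (-1) ^+ w.-1 * (y ^+ w)^-1 * (x^-1 - (x + y)^-1)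
    - \sum_(1 <= r < w) (-1) ^+ r * (y ^+ r)^-1 * (x ^+ (w.+1 - r))^-1.
Proof.
case: w => // w _ x0 y0 xy0.
elim: w => [|w IH].
  by rewrite big_geq// expr0; field; rewrite x0 y0 xy0.
rewrite exprS -mulrA invfM {}IH [in RHS]big_nat_recr//= mulrBr mulr_sumr.
rewrite [X in _ - X = _](_ : _ = \sum_(1 <= r < w.+1)
    (-1) ^+ r * (y ^+ r)^-1 * (x ^+ (w.+3 - r))^-1); last first.
  apply: eq_big_nat => r /andP[r1 rw].
  have -> : (w.+3 - r = (w.+2 - r).+1)%N by lia.
  by rewrite [in RHS]exprS invfM; ring.
have -> : (w.+3 - w.+1 = 2)%N by lia.
have : x^-1 * ((-1) ^+ w * (y ^+ w.+1)^-1 * (x^-1 - (x + y)^-1)) =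
   (-1) ^+ w.+1 * (y ^+ w.+2)^-1 * (x^-1 - (x + y)^-1) -
   (-1) ^+ w.+1 * (y ^+ w.+1)^-1 * (x ^+ 2)^-1.
  rewrite [(-1) ^+ w.+1]exprS [y ^+ w.+2]exprS; field.
  by rewrite expf_neq0// x0 y0 xy0.
by move=> ->; rewrite opprD addrA addrAC.
Qed.

Lemma sum_inv_expr_mul (F : fieldType) (a b : F) (w : nat) :
  a != 0 -> b != 0 -> a - b != 0 ->
  \sum_(1 <= j < w.+1) (a ^+ j * b ^+ (w.+1 - j))^-1 =
    ((b ^+ w)^-1 - (a ^+ w)^-1) / (a - b).
Proof.
move=> a0 b0 ab0; elim: w => [|w IH]; first by rewrite big_geq// !expr0 subrr mul0r.
rewrite big_nat_recr//= subSnn.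
have -> : \sum_(1 <= j < w.+1) (a ^+ j * b ^+ (w.+2 - j))^-1 =
    (\sum_(1 <= j < w.+1) (a ^+ j * b ^+ (w.+1 - j))^-1) / b.
  rewrite mulr_suml; apply: eq_big_nat => j /andP[j1 jw].
  by rewrite subSn ?exprSr 1?mulrA ?invfM//; lia.
rewrite {}IH ![_ ^+ w.+1]exprS expr1; field.
by rewrite !expf_neq0// a0 b0 ab0.
Qed.

(** * Double sums over even or odd numbers *)

Section Nodes.
Variable R : realType.

(** [alt_recip K x] is the sum of [(-1)^k / (x + 2k)] over [1 <= k <= K]. *)
Definition alt_recip (K : nat) (x : R) : R :=
  \sum_(1 <= k < K.+1) (-1) ^+ k / (x + 2 * k%:R).

Lemma alt_recip_tail K M x : 0 < x -> (K <= M)%N ->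
  `|alt_recip M x - alt_recip K x| <= (x + 2 * K.+1%:R)^-1.
Proof.
move=> x0 hKM; rewrite /alt_recip (@big_cat_nat _ _ _ K.+1 1 M.+1)//= addrAC subrr add0r.
have p0 k : 0 < x + 2 * k%:R by rewrite ltr_pwDl// mulr_ge0.
apply: (@alt_sum_norm_le R (fun k => (x + 2 * k%:R)^-1)) => k _.
  by rewrite lef_pV2 ?posrE// lerD2l ler_pM2l// ler_nat.
by rewrite invr_ge0 ltW.
Qed.

(** The uniform estimate behind every truncation: changing the number of terms
    costs at most [1 / B] as soon as both first omitted denominators are at
    least [B]. *)
Lemma alt_recip_close K M x (B : R) : 0 < x -> 0 < B ->
  B <= x + 2 * K.+1%:R -> B <= x + 2 * M.+1%:R ->
  `|alt_recip M x - alt_recip K x| <= B^-1.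
Proof.
move=> x0 B0 hK hM; have p0 k : 0 < x + 2 * k%:R by rewrite ltr_pwDl// mulr_ge0.
case: (leqP K M) => hKM.
  by apply: (le_trans (alt_recip_tail x0 hKM)); rewrite lef_pV2 ?posrE.
rewrite distrC; apply: (le_trans (alt_recip_tail x0 (ltnW hKM))).
by rewrite lef_pV2 ?posrE.
Qed.

Lemma weighted_sum_norm_le (c d : nat -> R) (N : nat) (B : R) :
  0 <= B ->
  (forall p, (1 <= p)%N -> `|c p| <= (p%:R ^+ 2)^-1) ->
  (forall p, (1 <= p <= N)%N -> `|d p| <= B) ->
  `|\sum_(1 <= p < N.+1) c p * d p| <= 2 * B.
Proof.
move=> B0 hc hd; apply: (le_trans (ler_norm_sum _ _ _)).
apply: (@le_trans _ _ (\sum_(1 <= p < N.+1) (p%:R ^+ 2)^-1 * B)).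
  apply: ler_sum_nat => p /andP[p1 pN]; rewrite normrM ler_pM//.
    exact: hc.
  by apply: hd; rewrite p1.
by rewrite -mulr_suml ler_wpM2r// sum_inv_sqr_le.
Qed.

(** The even numbers [2 p] ([e = false]) and the odd numbers [2 p - 1]
    ([e = true]). *)
Definition node (e : bool) (p : nat) : R := 2 * p%:R - e%:R.

Lemma node_ge e p : (1 <= p)%N -> p%:R <= node e p.
Proof.
move=> hp; have : (1 : R) <= p%:R by rewrite ler1n.
by case: e; rewrite /node /=; lra.
Qed.

Lemma node_gt0 e p : (1 <= p)%N -> 0 < node e p.
Proof. by move=> hp; apply: lt_le_trans (node_ge e hp); rewrite ltr0n. Qed.

Lemma nodeD e p k : node e (p + k) = node e p + 2 * k%:R.
Proof. by rewrite /node natrD; ring. Qed.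

Lemma inv_node_le e p w : (2 <= w)%N -> (1 <= p)%N ->
  `|(node e p ^+ w)^-1| <= (p%:R ^+ 2)^-1.
Proof.
move=> hw hp; rewrite ger0_norm ?invr_ge0 ?exprn_ge0 ?(ltW (node_gt0 _ _))//.
apply: le_trans (inv_expr_le_sqr R hw hp).
rewrite lef_pV2 ?posrE ?exprn_gt0 ?node_gt0 ?ltr0n//.
by rewrite lerXn2r ?nnegrE ?node_ge// (ltW (node_gt0 _ _)).
Qed.

(** [node_dsum e w N] is the sum of [(-1)^(p+q) / (x_q x_p^w)] over
    [1 <= p < q <= N], where [x_p = node e p]. *)
Definition node_dsum e w N : R :=
  \sum_(1 <= q < N.+1) \sum_(1 <= p < q)
    ((-1) ^+ q * (-1) ^+ p) / (node e q ^+ 1 * node e p ^+ w).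

(** The same sum with the difference [k = q - p] ranging over [1 <= k <= N]
    independently of [p]. *)
Definition node_box e w N : R :=
  \sum_(1 <= p < N.+1) (node e p ^+ w)^-1 * alt_recip N (node e p).

(** Partial sum of the series [X_e(j)]. *)
Definition node_psum e j N : R := \sum_(1 <= p < N.+1) (node e p ^+ j)^-1.

(** Partial sum of the series [A_e], the part of [node_box] that the telescoping
    term of the partial fraction decomposition produces. *)
Definition node_diag e w N : R :=
  \sum_(1 <= k < N.+1) (-1) ^+ k * (node_psum e 1 k / (2 * k%:R) ^+ w).

Lemma node_dsumE e w N : node_dsum e w N =
  \sum_(1 <= p < N.+1) (node e p ^+ w)^-1 * alt_recip (N - p) (node e p).
Proof.
rewrite /node_dsum (triangle_sum (fun p q => ((-1) ^+ q * (-1) ^+ p) /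
  (node e q ^+ 1 * node e p ^+ w))).
apply: eq_bigr => p _; rewrite mulr_sumr; apply: eq_bigr => k _.
have s2 : (-1) ^+ p * (-1) ^+ p = 1 :> R by rewrite -exprMn mulrNN mulr1 expr1n.
rewrite nodeD expr1 exprD invfM [(-1) ^+ p * _]mulrC -[_ * _ * (-1) ^+ p]mulrA s2.
by ring.
Qed.

Lemma node_dsum_box e w : (2 <= w)%N ->
  (fun N => node_dsum e w N - node_box e w N) @ \oo --> (0 : R).
Proof.
move=> hw; apply: (@cvg0_le_inv _ _ 2) => N.
rewrite node_dsumE /node_box -sumrB.
under eq_bigr do rewrite -mulrBr.
apply: weighted_sum_norm_le => [|p hp|p /andP[p1 pN]]; rewrite ?invr_ge0//.
  exact: inv_node_le.
have hN : node e N.+1 = node e p + 2 * (N - p).+1%:R.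
  by rewrite -nodeD; congr node; lia.
apply: alt_recip_close; rewrite ?node_gt0 ?ltr0n//.
  have := node_ge e p1; rewrite -[N.+1]addn1 natrD.
  have : (0 : R) <= N%:R by []. 
  have := node_gt0 e p1; lra.
by rewrite -hN node_ge.
Qed.

(** The sum telescopes up to the terms with [N < p <= N + k], each of which is at
    most [1 / (N + 1)]. *)
Lemma node_telescope e k N : (k <= N)%N ->
  `|\sum_(1 <= p < N.+1) ((node e p)^-1 - (node e p + 2 * k%:R)^-1)
    - node_psum e 1 k| <= k%:R / N.+1%:R.
Proof.
move=> hk.
have -> : \sum_(1 <= p < N.+1) ((node e p)^-1 - (node e p + 2 * k%:R)^-1)
    - node_psum e 1 k = - \sum_(N.+1 <= p < N.+1 + k) (node e p)^-1.
  rewrite sumrB.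
  have -> : \sum_(1 <= p < N.+1) (node e p + 2 * k%:R)^-1 =
      \sum_(k.+1 <= p < N.+1 + k) (node e p)^-1.
    rewrite -[k.+1]add1n [RHS]big_addn addnK.
    by apply: eq_bigr => p _; rewrite nodeD.
  rewrite /node_psum; under [X in _ - X]eq_bigr do rewrite expr1.
  have e1 : \sum_(1 <= p < N.+1 + k) (node e p)^-1 =
      \sum_(1 <= p < N.+1) (node e p)^-1 + \sum_(N.+1 <= p < N.+1 + k) (node e p)^-1.
    by rewrite -big_cat_nat//=; lia.
  have e2 : \sum_(1 <= p < N.+1 + k) (node e p)^-1 =
      \sum_(1 <= p < k.+1) (node e p)^-1 + \sum_(k.+1 <= p < N.+1 + k) (node e p)^-1.
    by rewrite -big_cat_nat//=; lia.
  by move: e1; rewrite e2; lra.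
rewrite normrN; apply: (le_trans (ler_norm_sum _ _ _)).
apply: (@le_trans _ _ (\sum_(N.+1 <= p < N.+1 + k) N.+1%:R^-1)); last first.
  by rewrite sumr_const_nat addKn mulr_natl.
apply: ler_sum_nat => p /andP[pN _].
have p1 : (1 <= p)%N by lia.
rewrite ger0_norm ?invr_ge0 ?(ltW (node_gt0 _ _))//.
rewrite lef_pV2 ?posrE ?node_gt0//; apply: le_trans (node_ge e p1).
by rewrite ler_nat.
Qed.

Lemma node_boxE e w N : odd w -> node_box e w N =
  \sum_(1 <= k < N.+1) (-1) ^+ k * ((2 * k%:R) ^+ w)^-1 *
    (\sum_(1 <= p < N.+1) ((node e p)^-1 - (node e p + 2 * k%:R)^-1))
  - \sum_(1 <= r < w) (-1) ^+ r / 2 ^+ r * zeta_bar_psum R r N *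
       node_psum e (w.+1 - r) N.
Proof.
move=> wodd.
have w1 : (1 <= w)%N by case: w wodd.
have -> : node_box e w N = \sum_(1 <= k < N.+1) \sum_(1 <= p < N.+1)
    (-1) ^+ k * (node e p ^+ w * (node e p + 2 * k%:R))^-1.
  rewrite exchange_big_nat /=; apply: eq_bigr => p _.
  by rewrite mulr_sumr; apply: eq_bigr => k _; rewrite invfM; ring.
have -> : \sum_(1 <= r < w) (-1) ^+ r / 2 ^+ r * zeta_bar_psum R r N *
    node_psum e (w.+1 - r) N = \sum_(1 <= k < N.+1) \sum_(1 <= p < N.+1)
    (-1) ^+ k * \sum_(1 <= r < w) (-1) ^+ r * ((2 * k%:R) ^+ r)^-1 *
      (node e p ^+ (w.+1 - r))^-1.
  under [RHS]eq_bigr => k _.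
    under eq_bigr do rewrite mulr_sumr.
    rewrite exchange_big_nat /=.
    over.
  rewrite [RHS]exchange_big_nat /=; apply: eq_bigr => r _.
  rewrite /zeta_bar_psum mulr_sumr mulr_suml; apply: eq_bigr => k _.
  rewrite /node_psum mulr_sumr; apply: eq_bigr => p _.
  by rewrite exprMn !invfM; ring.
rewrite -sumrB; apply: eq_big_nat => k /andP[k1 kN].
rewrite mulr_sumr -sumrB; apply: eq_big_nat => p /andP[p1 pN].
have x0 := node_gt0 e p1; have y0 : (0 : R) < 2 * k%:R by rewrite mulr_gt0// ltr0n.
have xy0 := addr_gt0 x0 y0.
rewrite (partial_fraction w1) ?(gt_eqF x0) ?(gt_eqF y0) ?(gt_eqF xy0)//.
have -> : (-1) ^+ w.-1 = 1 :> R.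
  by rewrite -signr_odd; case: w wodd {w1} => // w /= /negbTE ->.
by ring.
Qed.

Lemma node_box_diag e w : (3 <= w)%N -> odd w ->
  (fun N => node_box e w N - (node_diag e w N -
     \sum_(1 <= r < w) (-1) ^+ r / 2 ^+ r * zeta_bar_psum R r N *
       node_psum e (w.+1 - r) N)) @ \oo --> (0 : R).
Proof.
move=> hw wodd; apply: (@cvg0_le_inv _ _ 2) => N.
rewrite node_boxE// opprB addrA subrK /node_diag -sumrB.
(* The factor k of the telescoping error is absorbed by the weight (2 k)^-w,
   which leaves at most k^-2 because w >= 3. *)
rewrite (_ : \sum_(1 <= k < N.+1) _ = \sum_(1 <= k < N.+1)
   ((-1) ^+ k * ((2 * k%:R) ^+ w)^-1 * k%:R) *
   ((\sum_(1 <= p < N.+1) ((node e p)^-1 - (node e p + 2 * k%:R)^-1)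
     - node_psum e 1 k) / k%:R)); last first.
  apply: eq_big_nat => k /andP[k1 _].
  have k0 : (0 : R) < k%:R by rewrite ltr0n.
  rewrite [RHS]mulrACA -mulrA [k%:R * _]mulrC.
  by field; rewrite expf_neq0 ?mulf_neq0 ?gt_eqF//.
apply: weighted_sum_norm_le => [|k k1|k /andP[k1 kN]]; rewrite ?invr_ge0//.
  have k0 : (0 : R) < k%:R by rewrite ltr0n.
  case: w hw {wodd} => // v hv.
  rewrite -mulrA normrM normrX normrN1 expr1n mul1r ger0_norm; last first.
    by rewrite mulr_ge0 ?invr_ge0 ?exprn_ge0 ?mulr_ge0.
  apply: le_trans (inv_expr_le_sqr R (_ : (2 <= v)%N) k1) => //.
  have -> : ((2 * k%:R) ^+ v.+1)^-1 * k%:R = (2 ^+ v.+1)^-1 * (k%:R ^+ v)^-1 :> R.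
    by rewrite exprMn [k%:R ^+ v.+1]exprS; field; rewrite !expf_neq0 ?gt_eqF.
  rewrite ler_piMl ?invr_ge0 ?exprn_ge0//.
  by rewrite invf_le1 ?exprn_gt0// exprn_ege1// ler1n.
rewrite normrM (ger0_norm (_ : 0 <= k%:R^-1)) ?invr_ge0//.
rewrite ler_pdivrMr ?ltr0n// [leRHS]mulrC.
exact: node_telescope.
Qed.
End Nodes.

(** * Even, odd and weighted sums in terms of zeta partial sums *)

Section Evaluation.
Variable R : realType.

Lemma t_bar_bar_psumE w N : t_bar_bar_psum R 1 w N = node_dsum R true w N.
Proof. by []. Qed.

Lemma node_psum_even j N : node_psum R false j N = (2 ^+ j)^-1 * zeta_psum R j N.
Proof.
rewrite /node_psum /zeta_psum mulr_sumr; apply: eq_bigr => p _.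
by rewrite /node subr0 exprMn invfM.
Qed.

Lemma node_psum_odd j N : node_psum R true j N =
  zeta_psum R j (2 * N) - (2 ^+ j)^-1 * zeta_psum R j N.
Proof.
rewrite -node_psum_even /zeta_psum sum_odd_even -sumrB.
apply: eq_big_nat => p /andP[p1 pN]; rewrite /node subr0 natrB ?natrM; last lia.
by rewrite addrK.
Qed.

Lemma node_diag_even w N : node_diag R false w N =
  (2 ^+ w.+1)^-1 * (zeta_bar2_psum R w 1 N + zeta_bar_psum R w.+1 N).
Proof.
rewrite zeta_bar2_psumE /zeta_bar_psum -big_split mulr_sumr /=.
apply: eq_big_nat => n /andP[n1 nN].
have n0 : n%:R != 0 :> R by rewrite pnatr_eq0; lia.
rewrite node_psum_even /zeta_psum big_nat_recr//= exprMn ![_ ^+ w.+1]exprS !expr1.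
by field; rewrite !expf_neq0// n0.
Qed.

(** Partial sum of the series [B]: the terms in [(2 n)^-w] of the sum of
    [(-1)^n (m^-w - (2 n)^-w) / (2 n - m)] over [m < n], with opposite sign. *)
Definition outer_part w N : R :=
  \sum_(1 <= n < N.+1)
    (-1) ^+ n * ((\sum_(1 <= m < n) (2 * n%:R - m%:R)^-1) / (2 * n%:R) ^+ w).

Lemma node_diag_odd w N : node_diag R true w N = outer_part w N +
  (2 ^+ w.+1)^-1 * (zeta_bar2_psum R w 1 N + 2 * zeta_bar_psum R w.+1 N).
Proof.
rewrite zeta_bar2_psumE /zeta_bar_psum mulr_sumr -big_split mulr_sumr -big_split /=.
apply: eq_big_nat => n /andP[n1 nN].
have n0 : n%:R != 0 :> R by rewrite pnatr_eq0; lia.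
have -> : node_psum R true 1 n = \sum_(1 <= m < n) (2 * n%:R - m%:R)^-1 +
    2^-1 * (\sum_(1 <= m < n) (m%:R ^+ 1)^-1) + n%:R^-1.
  rewrite node_psum_odd /zeta_psum (@big_cat_nat _ _ _ n.+1 1)//=; last lia.
  (* the substitution m -> 2 n - m *)
  have -> : \sum_(1 <= m < n) (2 * n%:R - m%:R)^-1 =
      \sum_(n.+1 <= m < 2 * n) (m%:R ^+ 1)^-1 :> R.
    rewrite -[n.+1]add1n big_addn big_nat_rev /= (_ : (2 * n - n = n)%N); last lia.
    apply: eq_big_nat => m /andP[m1 mn].
    by rewrite expr1 -natrM -natrB; [congr (_%:R^-1); lia|lia].
  rewrite [\sum_(n.+1 <= m < (2 * n).+1) _]big_nat_recr//=; last lia.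
  rewrite big_nat_recr//= natrM; field.
  by [].
rewrite exprMn ![_ ^+ w.+1]exprS.
by field; rewrite !expf_neq0// n0.
Qed.

(** The geometric sum over [j], followed by the substitution [n = m + k] in the
    terms in [m^-w]. *)
Lemma zeta_bar2_psum_sum w N :
  \sum_(1 <= j < w.+1) 1 / 2 ^+ j * zeta_bar2_psum R j (w.+1 - j) N =
  \sum_(1 <= m < N.+1) (-1) ^+ m / m%:R ^+ w * alt_recip (N - m) m%:R
  - outer_part w N.
Proof.
have -> : \sum_(1 <= m < N.+1) (-1) ^+ m / m%:R ^+ w * alt_recip (N - m) m%:R =
  \sum_(1 <= n < N.+1) \sum_(1 <= m < n) (-1) ^+ n / m%:R ^+ w / (2 * n%:R - m%:R) :> R.
  rewrite (triangle_sum (fun m n => (-1) ^+ n / m%:R ^+ w / (2 * n%:R - m%:R))).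
  apply: eq_bigr => m _; rewrite mulr_sumr; apply: eq_bigr => k _.
  have -> : 2 * (m + k)%:R - m%:R = m%:R + 2 * k%:R :> R by rewrite natrD; ring.
  by rewrite exprD; ring.
rewrite /outer_part -sumrB /zeta_bar2_psum.
under eq_bigr do rewrite mulr_sumr.
rewrite exchange_big_nat /=; apply: eq_bigr => n _.
under eq_bigr do rewrite mulr_sumr.
rewrite exchange_big_nat /= mulr_suml mulr_sumr -sumrB.
apply: eq_big_nat => m /andP[m1 mn].
have m0 : (0 : R) < m%:R by rewrite ltr0n.
have n0 : (m%:R : R) < n%:R by rewrite ltr_nat.
have h : \sum_(1 <= j < w.+1) ((2 * n%:R) ^+ j * m%:R ^+ (w.+1 - j))^-1 =
    ((m%:R ^+ w)^-1 - ((2 * n%:R) ^+ w)^-1) / (2 * n%:R - m%:R) :> R.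
  by apply: sum_inv_expr_mul; rewrite gt_eqF//; lra.
transitivity ((-1) ^+ n *
  (\sum_(1 <= j < w.+1) ((2 * n%:R) ^+ j * m%:R ^+ (w.+1 - j))^-1 : R)).
  by rewrite mulr_sumr; apply: eq_bigr => j _; rewrite exprMn !invfM; ring.
by rewrite h; ring.
Qed.

Lemma cvg_double (u : nat -> R) (a : R) : u @ \oo --> a ->
  (fun N => u (2 * N)%N) @ \oo --> a.
Proof. by move=> hu; apply: (cvg_comp _ _ (@cvg_mulnl 2 isT)). Qed.

(** Splitting the sum over [m <= 2N] in [zeta_bar2_psum_sum] into even and odd
    [m]: the even part is [node_box false], and the odd part, where [(-1)^m] is
    [-1], is [node_box true]. *)
Lemma cvg_inner_part w : (2 <= w)%N ->
  (fun N => \sum_(1 <= m < (2 * N).+1)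
       (-1) ^+ m / m%:R ^+ w * alt_recip (2 * N - m) m%:R
     - (node_box R false w N - node_box R true w N)) @ \oo --> (0 : R).
Proof.
move=> hw; apply: (@cvg0_le_inv _ _ 4) => N.
have -> : node_box R false w N - node_box R true w N =
  \sum_(1 <= m < (2 * N).+1)
    (-1) ^+ m / m%:R ^+ w * alt_recip N m%:R.
  rewrite sum_odd_even /node_box -sumrB; apply: eq_big_nat => p /andP[p1 pN].
  rewrite /node subr0 natrB ?natrM; last lia.
  rewrite -signr_odd -[(-1) ^+ (2 * p)]signr_odd.
  have -> : odd (2 * p - 1) = true by lia.
  have -> : odd (2 * p) = false by lia.
  by rewrite expr1 expr0; ring.
rewrite -sumrB; under eq_bigr do rewrite -mulrBr.
have -> : 4 * N.+1%:R^-1 = 2 * (2 * N.+1%:R^-1) :> R by ring.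
apply: weighted_sum_norm_le => [|m m1|m /andP[m1 mN]].
- by rewrite mulr_ge0 ?invr_ge0.
- rewrite normrM normrX normrN1 expr1n mul1r ger0_norm ?invr_ge0 ?exprn_ge0//.
  exact: inv_expr_le_sqr.
- apply: (@le_trans _ _ N.+1%:R^-1); last by rewrite ler_peMl ?invr_ge0 ?ler1n.
  apply: alt_recip_close; rewrite ?ltr0n//.
    by rewrite ler_wpDl// -natrM ler_nat; lia.
  by rewrite -natrM -natrD ler_nat; lia.
Qed.

End Evaluation.

(** * Passage to the limit *)

Section Limits.
Variable R : realType.

Lemma cvg_close (u v : nat -> R) (a : R) :
  (fun N => u N - v N) @ \oo --> 0 -> v @ \oo --> a -> u @ \oo --> a.
Proof.
move=> huv hv; have h : (fun N => (u N - v N) + v N) @ \oo --> 0 + a by exact: cvgD.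
by move: h; rewrite add0r; under eq_fun do rewrite subrK.
Qed.

Lemma cvg_sum_nat (f : nat -> nat -> R) (l : nat -> R) (m n : nat) :
  (forall j, (m <= j < n)%N -> f j @ \oo --> l j) ->
  (fun N => \sum_(m <= j < n) f j N) @ \oo --> \sum_(m <= j < n) l j.
Proof.
move=> hf; elim: n hf => [|n IH] hf.
  by rewrite big_geq//; under eq_fun do rewrite big_geq//; exact: cvg_cst.
case: (leqP m n) => hmn; last first.
  by rewrite big_geq//; under eq_fun do rewrite big_geq//; exact: cvg_cst.
rewrite big_nat_recr//=; under eq_fun do rewrite big_nat_recr//=.
apply: cvgD; last by apply: hf; lia.
by apply: IH => j hj; apply: hf; lia.
Qed.

Lemma node_psum_cvg e j : (2 <= j)%N -> node_psum R e j @ \oo -->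
  (if e then zeta R j - (2 ^+ j)^-1 * zeta R j else (2 ^+ j)^-1 * zeta R j).
Proof.
move=> hj; have hz : zeta_psum R j @ \oo --> zeta R j := @zeta_psum_cvg R j hj.
have h0 : (fun N => (2 ^+ j)^-1 * zeta_psum R j N) @ \oo --> (2 ^+ j)^-1 * zeta R j.
  by apply: cvgM => //; exact: cvg_cst.
case: e; last by rewrite (funext (node_psum_even R j)).
rewrite (funext (node_psum_odd R j)); apply: cvgB => //; exact: cvg_double.
Qed.

Lemma node_dsum_cvg e w (a : R) : (3 <= w)%N -> odd w ->
  node_diag R e w @ \oo --> a ->
  node_dsum R e w @ \oo --> a - \sum_(1 <= r < w)
    (-1) ^+ r / 2 ^+ r * zeta_bar R r *
      (if e then zeta R (w.+1 - r) - (2 ^+ (w.+1 - r))^-1 * zeta R (w.+1 - r)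
       else (2 ^+ (w.+1 - r))^-1 * zeta R (w.+1 - r)).
Proof.
move=> hw wodd ha.
apply: (@cvg_close _ (node_box R e w)); first exact: node_dsum_box (ltnW hw).
apply: cvg_close (node_box_diag e hw wodd) _.
apply: cvgB ha _; apply: cvg_sum_nat => r /andP[r1 rw].
apply: cvgM; last by apply: node_psum_cvg; lia.
by apply: cvgM; [exact: cvg_cst|exact: (@zeta_bar_psum_cvg R r r1)].
Qed.

Lemma node_diag_odd_cvg w : (1 <= w)%N -> cvgn (node_diag R true w).
Proof.
move=> hw.
have -> : node_diag R true w = fun N => (2 ^+ w)^-1 *
    \sum_(1 <= n < N.+1) (-1) ^+ n * (node_psum R true 1 n / n%:R ^+ w).
  apply/funext => N; rewrite mulr_sumr; apply: eq_bigr => n _.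
  by rewrite exprMn invfM; ring.
apply: is_cvgM; first exact: is_cvg_cst.
apply: alt_sum_cvg => // n hn; rewrite /node_psum.
- rewrite big_ltn; last lia.
  rewrite /node mulr1 expr1 (_ : 2 - true%:R = 1 :> R); last by rewrite /=; lra.
  rewrite invr1 lerDl big_nat sumr_ge0// => i /andP[i1 _].
  by rewrite expr1 invr_ge0 ltW// node_gt0//; lia.
- by rewrite [leRHS]big_nat_recr//= lerDl expr1 invr_ge0 ltW// node_gt0.
- rewrite big_nat_recr//= lerD2l expr1 lef_pV2 ?posrE ?node_gt0 ?ltr0n//; last lia.
  by apply: le_trans (node_ge _ _ _) => //; rewrite ler_nat.
Qed.

(** The parity of [w] enters through the sign [(-1)^(w-1)] of the partial
    fraction decomposition. *)
Lemma t_bar_bar_odd_eval w : (3 <= w)%N -> odd w ->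
  cvgn (@t_bar_bar_psum R 1 w) /\
  2 * t_bar_bar R 1 w = (2 ^+ w.+1)^-1 *
      (2 * zeta_bar2 R w 1 + 3 * zeta_bar R w.+1)
    - \sum_(1 <= j < w.+1) 1 / 2 ^+ j * zeta_bar2 R j (w.+1 - j)
    - \sum_(1 <= r < w) (-1) ^+ r / 2 ^+ r * zeta_bar R r * zeta R (w.+1 - r).
Proof.
move=> hw wodd.
set c : R := (2 ^+ w.+1)^-1.
have hZ a b : (1 <= a)%N -> (1 <= b)%N ->
    zeta_bar2_psum R a b @ \oo --> zeta_bar2 R a b.
  by move=> ha hb; exact: (@zeta_bar2_psum_cvg R a b ha hb).
have hz : zeta_bar_psum R w.+1 @ \oo --> zeta_bar R w.+1.
  exact: (@zeta_bar_psum_cvg R w.+1).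
have hZw : zeta_bar2_psum R w 1 @ \oo --> zeta_bar2 R w 1 by apply: hZ; lia.
have [al hal] : exists al, node_diag R true w @ \oo --> (al : R).
  by apply/cvg_ex/node_diag_odd_cvg; lia.
have h1 := node_dsum_cvg hw wodd hal.
have hT : t_bar_bar_psum R 1 w @ \oo --> t_bar_bar R 1 w.
  by apply: cvgP h1.
split; first exact: cvgP hT.
have hd0 : node_diag R false w @ \oo --> c * (zeta_bar2 R w 1 + zeta_bar R w.+1).
  rewrite (funext (node_diag_even R w)); apply: cvgM; first exact: cvg_cst.
  exact: cvgD.
have h0 := node_dsum_cvg hw wodd hd0.
have hO : outer_part R w @ \oo --> al - c * (zeta_bar2 R w 1 + 2 * zeta_bar R w.+1).
  have -> : outer_part R w = fun N => node_diag R true w N -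
      c * (zeta_bar2_psum R w 1 N + 2 * zeta_bar_psum R w.+1 N).
    by apply/funext => N; rewrite node_diag_odd addrK.
  apply: cvgB hal _; apply: cvgM; first exact: cvg_cst.
  by apply: cvgD => //; apply: cvgM => //; exact: cvg_cst.
have hS : (fun N => \sum_(1 <= j < w.+1)
      1 / 2 ^+ j * zeta_bar2_psum R j (w.+1 - j) N) @ \oo -->
    \sum_(1 <= j < w.+1) 1 / 2 ^+ j * zeta_bar2 R j (w.+1 - j).
  apply: cvg_sum_nat => j /andP[j1 jw]; apply: cvgM; first exact: cvg_cst.
  by apply: hZ; lia.
set S := \sum_(1 <= j < w.+1) _ in hS *.
(* The two limits of the inner part, along even indices, are S + B and
   D_0 - D_1. *)
have hI : (fun N => \sum_(1 <= m < (2 * N).+1)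
      (-1) ^+ m / m%:R ^+ w * alt_recip (2 * N - m) m%:R) @ \oo -->
    S + (al - c * (zeta_bar2 R w 1 + 2 * zeta_bar R w.+1)).
  apply: (@cvg_double _ (fun M => \sum_(1 <= m < M.+1)
      (-1) ^+ m / m%:R ^+ w * alt_recip (M - m) m%:R)).
  rewrite (_ : (fun M : nat => _) = fun M => (\sum_(1 <= j < w.+1)
      1 / 2 ^+ j * zeta_bar2_psum R j (w.+1 - j) M) + outer_part R w M).
    exact: cvgD.
  by apply/funext => M; rewrite zeta_bar2_psum_sum subrK.
(* node_box inherits the limit of node_dsum. *)
have hbox e (a : R) : node_dsum R e w @ \oo --> a -> node_box R e w @ \oo --> a.
  move=> ha; have h : (fun N => node_dsum R e w N -
      (node_dsum R e w N - node_box R e w N)) @ \oo --> a - 0.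
    by apply: cvgB => //; exact: node_dsum_box (ltnW hw).
  by move: h; rewrite subr0; under eq_fun do rewrite subKr.
set C1 := \sum_(1 <= r < w) _ in h1; set C0 := \sum_(1 <= r < w) _ in h0.
have hB : (fun N => node_box R false w N - node_box R true w N) @ \oo -->
    c * (zeta_bar2 R w 1 + zeta_bar R w.+1) - C0 - (al - C1).
  by apply: cvgB; apply: hbox.
have hI' := cvg_close (cvg_inner_part (ltnW hw)) hB.
have eI : S + (al - c * (zeta_bar2 R w 1 + 2 * zeta_bar R w.+1)) =
    c * (zeta_bar2 R w 1 + zeta_bar R w.+1) - C0 - (al - C1).
  exact: (cvg_unique (@norm_hausdorff _ _) hI hI').
have eT : t_bar_bar R 1 w = al - C1 by exact: (cvg_unique (@norm_hausdorff _ _) hT h1).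
have -> : \sum_(1 <= r < w) (-1) ^+ r / 2 ^+ r * zeta_bar R r * zeta R (w.+1 - r) =
    C0 + C1.
  by rewrite -big_split; apply: eq_bigr => r _ /=; ring.
lra.
Qed.

Lemma harmonic_sub_log_cvg : cvgn (fun N => zeta_psum R 1 N - ln N%:R : R).
Proof.
suff : cvgn (fun N => zeta_psum R 1 N.+1 - ln N.+1%:R : R).
  move=> /cvg_ex[a].
  by rewrite (cvg_shiftS (fun N => zeta_psum R 1 N - ln N%:R)) => /cvgP.
(* ln (1 + x) <= x at x = - 1 / (n + 1) and at x = 1 / n *)
have hln (n : nat) : (1 <= n)%N ->
    (n.+1%:R^-1 : R) <= (ln n.+1%:R : R) - (ln n%:R : R) <= (n%:R^-1 : R).
  move=> n1; have n0 : (0 : R) < n%:R by rewrite ltr0n.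
  have m0 : (0 : R) < n.+1%:R by rewrite ltr0n.
  rewrite -ln_div ?posrE//; apply/andP; split.
    rewrite -[X in ln X]invf_div lnV ?posrE ?divr_gt0// lerNr.
    have -> : n%:R / n.+1%:R = 1 + - n.+1%:R^-1 :> R.
      by rewrite -addn1 natrD; field; rewrite natr1 gt_eqF.
    apply: le_ln1Dx; rewrite ltrN2 invf_lt1// ltr1n; lia.
  have -> : n.+1%:R / n%:R = 1 + n%:R^-1 :> R.
    by rewrite -addn1 natrD; field; rewrite gt_eqF.
  by apply: le_ln1Dx; rewrite (@lt_le_trans _ _ 0) ?invr_ge0 ?ltrN10.
apply: nonincreasing_is_cvgn.
  apply/nonincreasing_seqP => n.
  rewrite /zeta_psum [in leLHS]big_nat_recr//= expr1.
  by have /andP[h1 _] := hln n.+1 isT; rewrite -addrA lerD2l lerBlDr addrC; exact: h1.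
have hlow N : ln N.+1%:R <= zeta_psum R 1 N.
  elim: N => [|N IH]; first by rewrite ln1 sumr_ge0.
  rewrite /zeta_psum big_nat_recr//= expr1.
  have /andP[_] := hln N.+1 isT; rewrite lerBlDl => /le_trans; apply.
  by rewrite lerD2r.
exists 0 => _ [N _ <-]; rewrite subr_ge0; apply: (le_trans (hlow N)).
by rewrite /zeta_psum [leRHS]big_nat_recr//= lerDl expr1 invr_ge0.
Qed.

Lemma zeta_bar_psum_double a N : zeta_bar_psum R a (2 * N) =
  2 / 2 ^+ a * zeta_psum R a N - zeta_psum R a (2 * N).
Proof.
rewrite /zeta_psum /zeta_bar_psum !sum_odd_even mulr_sumr -sumrB.
apply: eq_big_nat => p /andP[p1 pN].
rewrite -signr_odd -[(-1) ^+ (2 * p)]signr_odd.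
have -> : odd (2 * p - 1) = true by lia.
have -> : odd (2 * p) = false by lia.
rewrite expr1 expr0 natrM exprMn invfM; ring.
Qed.

Lemma zeta_bar1 : zeta_bar R 1 = - ln 2.
Proof.
have hz : zeta_bar_psum R 1 @ \oo --> zeta_bar R 1 by exact: zeta_bar_psum_cvg.
apply: (cvg_unique (@norm_hausdorff _ _) (cvg_double hz)).
(* zeta_bar_psum R 1 (2 * N) is the N-th harmonic number minus the (2 N)-th,
   and the limit of (harmonic number - ln) cancels out. *)
have h : (fun N => (zeta_psum R 1 N - ln N%:R) -
    (zeta_psum R 1 (2 * N) - ln (2 * N)%:R) - ln 2) @ \oo --> - ln (2 : R).
  rewrite -[X in _ --> X]sub0r -(subrr (limn (fun N => zeta_psum R 1 N - ln N%:R : R))).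
  apply: cvgB; last exact: cvg_cst.
  by apply: cvgB; [exact: harmonic_sub_log_cvg|exact: (cvg_double harmonic_sub_log_cvg)].
move: h; apply: cvg_trans; apply: near_eq_cvg.
exists 1%N => // N /= N1; rewrite zeta_bar_psum_double natrM lnM ?posrE ?ltr0n//.
by rewrite expr1; lra.
Qed.

Lemma zeta_bar_zeta a : (2 <= a)%N ->
  zeta_bar R a = (2 / 2 ^+ a - 1) * zeta R a.
Proof.
move=> ha; have hb : zeta_bar_psum R a @ \oo --> zeta_bar R a.
  by apply: zeta_bar_psum_cvg; lia.
have hz : zeta_psum R a @ \oo --> zeta R a := @zeta_psum_cvg R a ha.
apply: (cvg_unique (@norm_hausdorff _ _) (cvg_double hb)).
rewrite (_ : (fun N => _) = fun N =>
    2 / 2 ^+ a * zeta_psum R a N - zeta_psum R a (2 * N)); last first.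
  by apply/funext => N; exact: zeta_bar_psum_double.
rewrite mulrBl mul1r; apply: cvgB (cvg_double hz).
by apply: cvgM => //; exact: cvg_cst.
Qed.

End Limits.

(** * The evaluation of the alternating double t value *)

Theorem proposition24 (R : realType) (l : nat) (hl : (1 <= l)%N) :
  [/\ (* all the series involved converge *)
      [/\ cvgn (@t_bar_bar_psum R 1 (2 * l + 1)),
          forall a b : nat, (1 <= a)%N -> (1 <= b)%N ->
            cvgn (@zeta_bar2_psum R a b),
          forall a : nat, (1 <= a)%N -> cvgn (@zeta_bar_psum R a) &
          forall s : nat, (2 <= s)%N -> cvgn (@zeta_psum R s)],
      (* the evaluation *)
      4 * t_bar_bar R 1 (2 * l + 1) =
        1 / 2 ^+ (2 * l) * zeta_bar2 R (2 * l + 1) 1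
        - 2 * (\sum_(1 <= j < (2 * l + 1).+1)
                 1 / 2 ^+ j * zeta_bar2 R j (2 * l + 2 - j))
        + 3 / 2 ^+ (2 * l + 1) * zeta_bar R (2 * l + 2)
        - \sum_(1 <= r < (2 * l).+1)
            (-1) ^+ r / 2 ^+ (r - 1) * zeta_bar R r * zeta R (2 * l + 2 - r) &
      (* in particular: a rational combination of the zeta(\bar j, 2l+2-j) and
         of products of Riemann zeta values and log 2 *)
      exists (c d : nat -> rat) (p q : rat),
        t_bar_bar R 1 (2 * l + 1) =
          \sum_(1 <= j < (2 * l + 1).+1)
             ratr (c j) * zeta_bar2 R j (2 * l + 2 - j)
          + ratr p * (ln 2 * zeta R (2 * l + 1))
          + ratr q * zeta R (2 * l + 2)
          + \sum_(2 <= r < (2 * l).+1)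
             ratr (d r) * (zeta R r * zeta R (2 * l + 2 - r))].
Proof.
have hw : (3 <= 2 * l + 1)%N by lia.
have wodd : odd (2 * l + 1) by lia.
have [cT eT] := t_bar_bar_odd_eval R hw wodd.
have e2 : (2 * l + 2 = (2 * l + 1).+1)%N by lia.
have pow2 : 2 ^+ (2 * l) != 0 :> R by rewrite expf_neq0.
have eval : 4 * t_bar_bar R 1 (2 * l + 1) =
    1 / 2 ^+ (2 * l) * zeta_bar2 R (2 * l + 1) 1
    - 2 * (\sum_(1 <= j < (2 * l + 1).+1)
             1 / 2 ^+ j * zeta_bar2 R j (2 * l + 2 - j))
    + 3 / 2 ^+ (2 * l + 1) * zeta_bar R (2 * l + 2)
    - \sum_(1 <= r < (2 * l).+1)
        (-1) ^+ r / 2 ^+ (r - 1) * zeta_bar R r * zeta R (2 * l + 2 - r).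
  have -> : \sum_(1 <= r < (2 * l).+1)
      (-1) ^+ r / 2 ^+ (r - 1) * zeta_bar R r * zeta R (2 * l + 2 - r) =
    2 * \sum_(1 <= r < 2 * l + 1)
      (-1) ^+ r / 2 ^+ r * zeta_bar R r * zeta R ((2 * l + 1).+1 - r).
    rewrite mulr_sumr -e2 addn1; apply: eq_big_nat => -[//|r] _.
    rewrite subn1 /= [2 ^+ r.+1]exprS; field.
    by rewrite expf_neq0.
  have -> : 4 * t_bar_bar R 1 (2 * l + 1) = 2 * (2 * t_bar_bar R 1 (2 * l + 1)).
    by rewrite mulrA -natrM.
  rewrite eT e2 addn1 !exprS; field.
  by [].
split=> //.
  split=> // [a b|a|s]; [exact: zeta_bar2_psum_cvg|exact: zeta_bar_psum_cvg|].
  exact: zeta_psum_cvg.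
(* The coefficients are read off the evaluation divided by 4; zeta_bar2 w 1 is
   also the last term, j = w, of the sum over j, whence the case distinction. *)
exists (fun j => - (2 * 2 ^+ j)^-1 +
  (if j == (2 * l + 1)%N then (4 * 2 ^+ (2 * l))^-1 else 0)).
exists (fun r => - ((-1) ^+ r / 2 ^+ (r - 1) * (2 / 2 ^+ r - 1) / 4)).
exists (- (1 / 4)), (3 / 2 ^+ (2 * l + 1) * (2 / 2 ^+ (2 * l + 2) - 1) / 4).
have -> : t_bar_bar R 1 (2 * l + 1) = 4 * t_bar_bar R 1 (2 * l + 1) / 4 by field.
rewrite {}eval (@zeta_bar_zeta R (2 * l + 2)); last lia.
have -> : \sum_(1 <= r < (2 * l).+1)
    (-1) ^+ r / 2 ^+ (r - 1) * zeta_bar R r * zeta R (2 * l + 2 - r) =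
  ln 2 * zeta R (2 * l + 1) - 4 * \sum_(2 <= r < (2 * l).+1)
    ratr (- ((-1) ^+ r / 2 ^+ (r - 1) * (2 / 2 ^+ r - 1) / 4) : rat) *
      (zeta R r * zeta R (2 * l + 2 - r)).
  rewrite big_ltn; last lia.
  rewrite zeta_bar1 expr1 expr0 (_ : (2 * l + 2 - 1 = 2 * l + 1)%N); last lia.
  rewrite mulr_sumr -sumrN invr1 mulr1 mulrNN mul1r; congr (_ + _).
  apply: eq_big_nat => r /andP[r1 _]; rewrite zeta_bar_zeta//.
  rewrite !(rmorph_nat, rmorph1, fmorphV, rmorphXn, rmorphM, rmorphN, rmorphD) /=.
  by field; rewrite !expf_neq0.
have -> : \sum_(1 <= j < (2 * l + 1).+1)
   ratr (- (2 * 2 ^+ j)^-1 +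
    (if j == (2 * l + 1)%N then (4 * 2 ^+ (2 * l))^-1 else 0) : rat) *
   zeta_bar2 R j (2 * l + 2 - j) =
  (1 / 2 ^+ (2 * l) * zeta_bar2 R (2 * l + 1) 1
   - 2 * \sum_(1 <= j < (2 * l + 1).+1)
       1 / 2 ^+ j * zeta_bar2 R j (2 * l + 2 - j)) / 4.
  rewrite !big_nat_recr//=; [|lia..].
  rewrite eqxx (_ : (2 * l + 2 - (2 * l + 1) = 1)%N); last lia.
  rewrite [X in X + _ = _](_ : _ = - 2^-1 * \sum_(1 <= j < 2 * l + 1)
      1 / 2 ^+ j * zeta_bar2 R j (2 * l + 2 - j)); last first.
    rewrite mulr_sumr; apply: eq_big_nat => j /andP[_ jl].
    rewrite (ltn_eqF jl) addr0.
    rewrite !(rmorph_nat, rmorph1, fmorphV, rmorphXn, rmorphM, rmorphN, rmorphD) /=.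
    by field; rewrite expf_neq0.
  rewrite !(rmorph_nat, rmorph1, fmorphV, rmorphXn, rmorphM, rmorphN, rmorphD) /=.
  by field; rewrite !expf_neq0.
rewrite !(rmorph_nat, rmorph1, fmorphV, rmorphXn, rmorphM, rmorphN, rmorphD) /=.
by field; rewrite !expf_neq0.
Qed.
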